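(* Let $({\bf H}^n,{\bf E}^n)_{0\le n\le M}$ be the solution of the scheme $$\mu\,\frac{{\bf H}^{n+1}-{\bf H}^n}{\tau}=-\hat{\bf D}\,\frac{{\bf E}^{n+1}+{\bf E}^n}{2},\qquad \epsilon\,\frac{{\bf E}^{n+1}-{\bf E}^n}{\tau}=\hat{\bf D}\,\frac{{\bf H}^{n+1}+{\bf H}^n}{2},\qquad n=0,\dots,M-1 .$$ Then for each $w\in\{x,y,z\}$ the following discrete energy conservation laws hold: $$\mathcal E_{4_w}^{n+1}=\mathcal E_{4_w}^n,\qquad \mathcal E_{4_w}^n=\mu\|{\bf H}^n\|_{{\bf D}_1^w,h}^2+\epsilon\|{\bf E}^n\|_{{\bf D}_1^w,h}^2,\qquad n=0,\dots,M-1,$$ and $$\mathcal E_{5_w}^{n+1}=\mathcal E_{5_w}^n,\qquad \mathcal E_{5_w}^n=\mu\|\hat\delta_t{\bf H}^{n-1/2}\|_{{\bf D}_1^w,h}^2+\epsilon\|\hat\delta_t{\bf E}^{n-1/2}\|_{{\bf D}_1^w,h}^2,\qquad n=1,\dots,M-1.$$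
   Context: Grid: $N_x,N_y,N_z$ are even positive integers, the domain is $[x_L,x_R]\times[y_L,y_R]\times[z_L,z_R]$, $L_w=w_R-w_L$, $h_w=L_w/N_w$, $\mu_w=2\pi/L_w$ for $w\in\{x,y,z\}$; $w_j=w_L+(j-1)h_w$, $j=1,\dots,N_w$. Time step $\tau=T/M$, $T>0$, $M$ a positive integer. $\epsilon,\mu>0$ are constants and $c=1/\sqrt{\epsilon\mu}$. Put $s_1=N_xN_yN_z$. ${\bf D}_1^w\in\mathbb R^{N_w\times N_w}$ is the Fourier spectral first-order differentiation matrix: $({\bf D}_1^w)_{j,l}=\tfrac12\mu_w(-1)^{j+l}\cot\big(\mu_w\tfrac{w_j-w_l}{2}\big)$ for $j\ne l$, and $({\bf D}_1^w)_{j,j}=0$. Put ${\bf D}_1={\bf I}_{N_z}\otimes{\bf I}_{N_y}\otimes{\bf D}_1^x$, ${\bf D}_2={\bf I}_{N_z}\otimes{\bf D}_1^y\otimes{\bf I}_{N_x}$, ${\bf D}_3={\bf D}_1^z\otimes{\bf I}_{N_y}\otimes{\bf I}_{N_x}$ ($\otimes$ the Kronecker product), acting on grid functions $U_{j,k,m}$ ordered as vectors in $\mathbb R^{s_1}$ with $j$ varying fastest, then $k$, then $m$. Let $${\bf D}=\begin{pmatrix}0&-{\bf D}_3&{\bf D}_2\\ {\bf D}_3&0&-{\bf D}_1\\ -{\bf D}_2&{\bf D}_1&0\end{pmatrix},\qquad \hat{\bf D}={\bf D}+\frac{c^2\tau^2}{12}{\bf D}^3+\frac{c^4\tau^4}{120}{\bf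 D}^5 .$$ Unknowns ${\bf H}^n=(({\bf H}_x^n)^T,({\bf H}_y^n)^T,({\bf H}_z^n)^T)^T$ and ${\bf E}^n=(({\bf E}_x^n)^T,({\bf E}_y^n)^T,({\bf E}_z^n)^T)^T$ lie in $\mathbb R^{3s_1}$. For grid functions, $\langle{\bf U},{\bf V}\rangle_h=h_xh_yh_z\sum_{j,k,m}U_{j,k,m}\overline{V_{j,k,m}}$. The semi-norms of a grid function ${\bf U}$ are $\|{\bf U}\|_{{\bf D}_1^x,h}=\langle{\bf D}_1{\bf U},{\bf D}_1{\bf U}\rangle_h^{1/2}$, $\|{\bf U}\|_{{\bf D}_1^y,h}=\langle{\bf D}_2{\bf U},{\bf D}_2{\bf U}\rangle_h^{1/2}$, $\|{\bf U}\|_{{\bf D}_1^z,h}=\langle{\bf D}_3{\bf U},{\bf D}_3{\bf U}\rangle_h^{1/2}$; for a three-component vector ${\bf U}$ with components ${\bf U}_x,{\bf U}_y,{\bf U}_z$, $\|{\bf U}\|_{{\bf D}_1^w,h}^2=\|{\bf U}_x\|_{{\bf D}_1^w,h}^2+\|{\bf U}_y\|_{{\bf D}_1^w,h}^2+\|{\bf U}_z\|_{{\bf D}_1^w,h}^2$. The difference quotient is $\hat\delta_t{\bf U}^{n-1/2}=({\bf U}^n-{\bf U}^{n-1})/\tau$. *)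

(* Defs.v *)
From HB Require Import structures.
From mathcomp Require Import all_boot all_order all_algebra.
From mathcomp Require Import mxtens.
From mathcomp Require Import all_classical all_reals all_analysis.

Set Implicit Arguments.
Unset Strict Implicit.
Unset Printing Implicit Defensive.

Import Order.TTheory GRing.Theory Num.Theory.
Local Open Scope ring_scope.

Definition cot {R : realType} (x : R) : R := cos x / sin x.

Inductive axis := axX | axY | axZ.

Section Grid.
Context {R : realType}.
Variables (N : axis -> nat) (wL wR : axis -> R).

Definition side (w : axis) : R := wR w - wL w.
Definition step (w : axis) : R := side w / (N w)%:R.
Definition freq (w : axis) : R := 2 * pi / side w.

(* Indices run over 0 .. N w - 1, so that node w j is the usual w_{j+1}; the
   shift changes neither w_j - w_l nor the parity of j + l. *)
Definition node (w : axis) (j : 'I_(N w)) : R := wL w + j%:R * step w.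

Definition fourier_diff (w : axis) : 'M[R]_(N w) :=
  \matrix_(j, l)
    if j == l then 0
    else 2^-1 * freq w * (-1) ^+ (j + l)
         * cot (freq w * ((node j - node l) / 2)).

Definition gsize : nat := (N axZ * N axY * N axX)%N.

(* mxtens_index (a, b) = a * n + b for b : 'I_n, hence j varies fastest, then
   k, then m, consistently with the Kronecker product *t. *)
Definition grid_index (j : 'I_(N axX)) (k : 'I_(N axY)) (m : 'I_(N axZ)) : 'I_gsize :=
  mxtens_index (mxtens_index (m, k), j).

Definition grid_diff (w : axis) : 'M[R]_gsize :=
  match w with
  | axX => tensmx (tensmx (1%:M : 'M[R]_(N axZ)) (1%:M : 'M[R]_(N axY))) (fourier_diff axX)
  | axY => tensmx (tensmx (1%:M : 'M[R]_(N axZ)) (fourier_diff axY)) (1%:M : 'M[R]_(N axX))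
  | axZ => tensmx (tensmx (fourier_diff axZ) (1%:M : 'M[R]_(N axY))) (1%:M : 'M[R]_(N axX))
  end.

Definition vsize : nat := (gsize + (gsize + gsize))%N.

Definition curl_mx : 'M[R]_vsize :=
  let D1 := grid_diff axX in
  let D2 := grid_diff axY in
  let D3 := grid_diff axZ in
  col_mx (row_mx 0 (row_mx (- D3) D2))
 (col_mx (row_mx D3 (row_mx 0 (- D1)))
         (row_mx (- D2) (row_mx D1 0))).

Definition hat_curl_mx (c tau : R) : 'M[R]_vsize :=
  curl_mx + (c ^+ 2 * tau ^+ 2 / 12) *: curl_mx ^+ 3
          + (c ^+ 4 * tau ^+ 4 / 120) *: curl_mx ^+ 5.

Definition component (w : axis) (U : 'cV[R]_vsize) : 'cV[R]_gsize :=
  match w with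
  | axX => usubmx U
  | axY => usubmx (dsubmx U)
  | axZ => dsubmx (dsubmx U)
  end.

(* Grid functions are real, so no conjugation appears on V. *)
Definition grid_dot (U V : 'cV[R]_gsize) : R :=
  step axX * step axY * step axZ *
  \sum_(j < N axX) \sum_(k < N axY) \sum_(m < N axZ)
     U (grid_index j k m) 0 * V (grid_index j k m) 0.

Definition seminorm (w : axis) (U : 'cV[R]_gsize) : R :=
  Num.sqrt (grid_dot (grid_diff w *m U) (grid_diff w *m U)).

Definition vseminorm2 (w : axis) (U : 'cV[R]_vsize) : R :=
  seminorm w (component axX U) ^+ 2 + seminorm w (component axY U) ^+ 2
  + seminorm w (component axZ U) ^+ 2.

(* diffq tau U n is the quotient at time level n - 1/2; it is meant for n >= 1. *)
Definition diffq (tau : R) (U : nat -> 'cV[R]_vsize) (n : nat) : 'cV[R]_vsize :=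
  tau^-1 *: (U n - U n.-1).

Definition light_speed (eps mu : R) : R := 1 / Num.sqrt (eps * mu).

Definition is_scheme_solution (eps mu tau : R) (M : nat)
    (H E : nat -> 'cV[R]_vsize) : Prop :=
  let Dh := hat_curl_mx (light_speed eps mu) tau in
  forall n, (n < M)%N ->
    mu *: (tau^-1 *: (H n.+1 - H n)) = - Dh *m (2^-1 *: (E n.+1 + E n)) /\
    eps *: (tau^-1 *: (E n.+1 - E n)) = Dh *m (2^-1 *: (H n.+1 + H n)).

Definition energy4 (eps mu : R) (H E : nat -> 'cV[R]_vsize) (w : axis)
    (n : nat) : R :=
  mu * vseminorm2 w (H n) + eps * vseminorm2 w (E n).

Definition energy5 (eps mu tau : R) (H E : nat -> 'cV[R]_vsize) (w : axis)
    (n : nat) : R :=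
  mu * vseminorm2 w (diffq tau H n) + eps * vseminorm2 w (diffq tau E n).

End Grid.

(* Main.v *)
Require Import Defs.
From mathcomp Require Import all_boot all_order all_algebra.
From mathcomp Require Import mxtens ring.
From mathcomp Require Import all_classical all_reals all_analysis.

(** Every directional matrix [grid_diff w] is skew-symmetric, because [cot] is
    odd, and the three of them commute, because they act on different Kronecker
    factors.  Hence the discrete curl [curl_mx] is symmetric (transposing it
    swaps the signs of its off-diagonal blocks, and skew-symmetry of the blocks
    swaps them back), and it commutes with the matrix [vgrid_diff w] that
    differentiates all three components along [w].  Both properties pass to the
    polynomial [hat_curl_mx] in the curl ([hat_curl_mx_sym],
    [vgrid_diff_comm_hat_curl]).

    The squared semi-norm along [w] is a multiple of the quadratic form
    [mxform S] with [S = P^T P] and [P = vgrid_diff w] ([vseminorm2E]); since [A = hat_curl_mx]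
    is symmetric and commutes with [P], it commutes with [S] and is therefore
    self-adjoint for the form.  In one step
    of the scheme, the increment of the form from [H] to [H'] is the form paired
    between [H' - H] and [H' + H], which the scheme turns into a multiple of the
    pairing of [A (E' + E)] with [H' + H]; the electric increment produces the
    same pairing with the opposite sign and, once weighted by [mu] and [eps],
    the two cancel ([midpoint_step_conserves]).

    The scheme is linear with coefficients independent of time, so the
    difference quotients of a solution perform a step of the same scheme
    ([midpoint_step_diffq]); the second family of laws is thus the first one
    applied to the difference quotients. *)

Import Order.TTheory GRing.Theory Num.Theory.
Local Open Scope ring_scope.

(** * Quadratic invariants of the implicit midpoint rule *)

(** The trace only serves to turn the 1 x 1 matrix into a scalar. *)
Definition mxform {R : comPzRingType} {n : nat} (S : 'M[R]_n) (u v : 'cV[R]_n) : R :=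
  \tr (u^T *m S *m v).

Lemma mxformBl {R : comPzRingType} {n} (S : 'M[R]_n) u u' v :
  mxform S (u - u') v = mxform S u v - mxform S u' v.
Proof. by rewrite /mxform !raddfB /= !mulmxBl raddfB. Qed.

Lemma mxformDr {R : comPzRingType} {n} (S : 'M[R]_n) u v v' :
  mxform S u (v + v') = mxform S u v + mxform S u v'.
Proof. by rewrite /mxform mulmxDr raddfD. Qed.

Lemma mxformZl {R : comPzRingType} {n} (S : 'M[R]_n) a u v :
  mxform S (a *: u) v = a * mxform S u v.
Proof. by rewrite /mxform linearZ /= -!scalemxAl mxtraceZ. Qed.

Lemma mxform_sym {R : comPzRingType} {n} (S : 'M[R]_n) u v :
  S^T = S -> mxform S u v = mxform S v u.
Proof. by move=> ST; rewrite /mxform -mxtrace_tr !trmx_mul trmxK ST mulmxA. Qed.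

Lemma mxform_adj {R : comPzRingType} {n} (S A : 'M[R]_n) u v :
  A^T = A -> A *m S = S *m A -> mxform S (A *m u) v = mxform S u (A *m v).
Proof.
by move=> AT AS; rewrite /mxform trmx_mul AT -(mulmxA _ A) AS !mulmxA.
Qed.

Lemma mxform_subr_sqr {R : comPzRingType} {n} (S : 'M[R]_n) u v :
  S^T = S -> mxform S (u - v) (u + v) = mxform S u u - mxform S v v.
Proof.
by move=> ST; rewrite mxformBl !mxformDr (mxform_sym _ v u) //; ring.
Qed.

Definition midpoint_step {R : fieldType} {n} (A : 'M[R]_n) (eps mu tau : R)
    (h e h' e' : 'cV[R]_n) : Prop :=
  mu *: (tau^-1 *: (h' - h)) = - A *m (2^-1 *: (e' + e)) /\
  eps *: (tau^-1 *: (e' - e)) = A *m (2^-1 *: (h' + h)).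

(** Pairing the first equation with [h' + h] and the second with [e' + e] makes
    the two right-hand sides opposite, as [A] is self-adjoint for [S]. *)
Lemma midpoint_step_conserves {R : fieldType} {n} (A S : 'M[R]_n)
    (eps mu tau : R) (h e h' e' : 'cV[R]_n) :
  tau != 0 -> A^T = A -> S^T = S -> A *m S = S *m A ->
  midpoint_step A eps mu tau h e h' e' ->
  mu * mxform S h' h' + eps * mxform S e' e' =
  mu * mxform S h h + eps * mxform S e e.
Proof.
move=> tau0 AT ST AS [hstep estep].
have := congr1 (fun u => mxform S u (h' + h)) hstep.
rewrite mulNmx -scalemxAr -scaleNr !mxformZl mxform_subr_sqr // => hform.
have := congr1 (fun u => mxform S u (e' + e)) estep.
rewrite -scalemxAr !mxformZl mxform_subr_sqr // mxform_adj // mxform_sym //.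
move=> eform.
(* the sum of the two identities is the claim divided by [tau] *)
apply/eqP; rewrite -subr_eq0 -(mulrI_eq0 _ (mulfI (invr_neq0 tau0))); apply/eqP.
by move: (congr2 +%R hform eform); rewrite mulNr addNr => <-; ring.
Qed.

(** * Skew-symmetry and commutation of the directional derivatives *)

Lemma cotN {R : realType} (x : R) : cot (- x) = - cot x.
Proof. by rewrite /cot cosN sinN invrN mulrN. Qed.

Lemma fourier_diff_skew {R : realType} (N : axis -> nat) (wL wR : axis -> R) w :
  (fourier_diff N wL wR w)^T = - fourier_diff N wL wR w.
Proof.
apply/matrixP => j l; rewrite !mxE eq_sym addnC.
case: eqP => _; first by rewrite oppr0.
by rewrite -[X in cot (_ * (X / 2))]opprB mulNr mulrN cotN mulrN.
Qed.

Lemma tensmxN {R : comPzRingType} {m n p q} (A : 'M[R]_(m, n)) (B : 'M[R]_(p, q)) :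
  tensmx A (- B) = - tensmx A B.
Proof. by apply/matrixP => i j; rewrite !mxE mulrN. Qed.

Lemma tensNmx {R : comPzRingType} {m n p q} (A : 'M[R]_(m, n)) (B : 'M[R]_(p, q)) :
  tensmx (- A) B = - tensmx A B.
Proof. by apply/matrixP => i j; rewrite !mxE mulNr. Qed.

Lemma grid_diff_skew {R : realType} (N : axis -> nat) (wL wR : axis -> R) w :
  (grid_diff N wL wR w)^T = - grid_diff N wL wR w.
Proof.
by case: w; rewrite /grid_diff !trmx_tens !trmx1 fourier_diff_skew
  ?tensmxN ?tensNmx ?tensmxN.
Qed.

(** Along distinct axes the two matrices act on different Kronecker factors, so
    either product is the Kronecker product of the one-dimensional matrices. *)
Lemma grid_diff_comm {R : realType} (N : axis -> nat) (wL wR : axis -> R) v w :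
  grid_diff N wL wR v *m grid_diff N wL wR w =
  grid_diff N wL wR w *m grid_diff N wL wR v.
Proof.
by case: v w => -[] //; rewrite /grid_diff !tensmx_mul !mulmx1 !mul1mx.
Qed.

(** * The discrete curl *)

Definition vgrid_diff {R : realType} (N : axis -> nat) (wL wR : axis -> R) (w : axis) :
    'M[R]_(vsize N) :=
  block_mx (grid_diff N wL wR w) 0 0
    (block_mx (grid_diff N wL wR w) 0 0 (grid_diff N wL wR w)).

(** Splitting off the first component, in rows and in columns, makes the calculus
    of 2 x 2 blocks apply, for transposition as well as for products. *)
Lemma curl_mxE {R : realType} (N : axis -> nat) (wL wR : axis -> R) :
  curl_mx N wL wR =
  block_mx 0
    (row_mx (- grid_diff N wL wR axZ) (grid_diff N wL wR axY))
    (col_mx (grid_diff N wL wR axZ) (- grid_diff N wL wR axY))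
    (block_mx 0 (- grid_diff N wL wR axX) (grid_diff N wL wR axX) 0).
Proof.
rewrite /curl_mx [RHS]/block_mx; congr (col_mx _ _).
exact: block_mxEh.
Qed.

Lemma curl_mx_sym {R : realType} (N : axis -> nat) (wL wR : axis -> R) :
  (curl_mx N wL wR)^T = curl_mx N wL wR.
Proof.
rewrite curl_mxE !tr_block_mx tr_row_mx tr_col_mx !trmx0.
by rewrite -!grid_diff_skew !trmxK.
Qed.

Lemma vgrid_diff_comm_curl {R : realType} (N : axis -> nat) (wL wR : axis -> R) w :
  vgrid_diff N wL wR w *m curl_mx N wL wR =
  curl_mx N wL wR *m vgrid_diff N wL wR w.
Proof.
rewrite curl_mxE /vgrid_diff !mulmx_block !mul0mx !mulmx0 !addr0 !add0r.
rewrite !mul_block_col !mul_row_block !mul_mx_row !mul_col_mx.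
rewrite !mul0mx !mulmx0 !addr0 !add0r.
by rewrite !mulmxN !mulNmx !(grid_diff_comm _ _ _ w).
Qed.

(** A polynomial in a symmetric matrix is symmetric. *)
Lemma hat_curl_mx_sym {R : realType} (N : axis -> nat) (wL wR : axis -> R) c tau :
  (hat_curl_mx N wL wR c tau)^T = hat_curl_mx N wL wR c tau.
Proof.
have powT k : (curl_mx N wL wR ^+ k)^T = curl_mx N wL wR ^+ k.
  elim: k => [|k IHk]; first by rewrite !expr0 trmx1.
  by rewrite {1}exprS trmx_mul IHk curl_mx_sym exprSr.
by rewrite /hat_curl_mx !linearD !linearZ /= !powT curl_mx_sym.
Qed.

Lemma vgrid_diff_comm_hat_curl {R : realType} (N : axis -> nat) (wL wR : axis -> R)
    c tau w :
  vgrid_diff N wL wR w *m hat_curl_mx N wL wR c tau =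
  hat_curl_mx N wL wR c tau *m vgrid_diff N wL wR w.
Proof.
have cP := vgrid_diff_comm_curl N wL wR w.
have cPX k : vgrid_diff N wL wR w *m curl_mx N wL wR ^+ k =
    curl_mx N wL wR ^+ k *m vgrid_diff N wL wR w := commrX k cP.
by rewrite /hat_curl_mx !mulmxDl !mulmxDr -!scalemxAl -!scalemxAr cP !cPX.
Qed.

(** * The semi-norms as quadratic forms *)

(** [grid_index] is a bijection from triples of indices onto ['I_(gsize N)], so
    the triple sum runs once over each entry. *)
Lemma grid_dotE {R : realType} (N : axis -> nat) (wL wR : axis -> R)
    (U V : 'cV[R]_(gsize N)) :
  grid_dot wL wR U V =
  step N wL wR axX * step N wL wR axY * step N wL wR axZ * \tr (U^T *m V).
Proof.
rewrite /grid_dot; congr (_ * _).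
rewrite /mxtrace big_ord1 mxE.
under [RHS]eq_bigr do rewrite mxE.
rewrite (reindex (fun p : 'I_(N axX) * ('I_(N axY) * 'I_(N axZ)) =>
  grid_index p.1 p.2.1 p.2.2)) /=.
  rewrite -(pair_bigA _ (fun j q => U (grid_index j q.1 q.2) 0 * V (grid_index j q.1 q.2) 0)) /=.
  apply: eq_bigr => j _.
  by rewrite -(pair_bigA _ (fun k m => U (grid_index j k m) 0 * V (grid_index j k m) 0)).
exists (fun i => let: (mk, j) := mxtens_unindex i in
                 let: (m, k) := mxtens_unindex mk in (j, (k, m))).
  by move=> [j [k m]] _; rewrite /grid_index !mxtens_indexK.
move=> i _; rewrite /grid_index.
case: (mxtens_indexP i) => mk j; case: (mxtens_indexP mk) => m k.
by rewrite !mxtens_indexK.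
Qed.

Lemma component_vgrid_diff {R : realType} (N : axis -> nat) (wL wR : axis -> R) v w
    (U : 'cV[R]_(vsize N)) :
  component v (vgrid_diff N wL wR w *m U) = grid_diff N wL wR w *m component v U.
Proof.
rewrite -[U]vsubmxK -[dsubmx U]vsubmxK /vgrid_diff !mul_block_col !mul0mx !addr0 !add0r.
by case: v; rewrite /component /= ?col_mxKu ?col_mxKd ?col_mxKu ?col_mxKd.
Qed.

Lemma mxtrace_component {R : realType} (N : axis -> nat) (U V : 'cV[R]_(vsize N)) :
  \tr (U^T *m V) = \tr ((component axX U)^T *m component axX V)
    + \tr ((component axY U)^T *m component axY V)
    + \tr ((component axZ U)^T *m component axZ V).
Proof.
rewrite -{1}[U]vsubmxK -{1}[V]vsubmxK -{1}[dsubmx U]vsubmxK -{1}[dsubmx V]vsubmxK.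
by rewrite !tr_col_mx !mul_row_col !raddfD /= addrA.
Qed.

(** The grid steps being nonnegative, each square root is taken of a nonnegative
    number and squaring undoes it. *)
Lemma vseminorm2E {R : realType} (N : axis -> nat) (wL wR : axis -> R) w
    (U : 'cV[R]_(vsize N)) :
  (forall v, wL v < wR v) ->
  vseminorm2 wL wR w U =
  step N wL wR axX * step N wL wR axY * step N wL wR axZ *
  mxform ((vgrid_diff N wL wR w)^T *m vgrid_diff N wL wR w) U U.
Proof.
move=> ltLR.
have step_ge0 v : 0 <= step N wL wR v.
  by rewrite /step /side divr_ge0 ?ler0n // subr_ge0 ltW.
have dot_ge0 (V : 'cV[R]_(gsize N)) : 0 <= grid_dot wL wR V V.
  rewrite /grid_dot; apply: mulr_ge0.
    exact: mulr_ge0 (mulr_ge0 (step_ge0 axX) (step_ge0 axY)) (step_ge0 axZ).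
  by do 3![apply: sumr_ge0 => ? _]; rewrite -expr2 sqr_ge0.
rewrite /vseminorm2 /seminorm !sqr_sqrtr ?dot_ge0 // -!component_vgrid_diff.
rewrite !grid_dotE -!mulrDr -mxtrace_component /mxform trmx_mul.
by rewrite !mulmxA.
Qed.

(** * Conservation along the scheme *)

Lemma midpoint_step_vseminorm2 {R : realType} (N : axis -> nat) (wL wR : axis -> R)
    (c eps mu tau : R) (h e h' e' : 'cV[R]_(vsize N)) w :
  (forall v, wL v < wR v) -> tau != 0 ->
  midpoint_step (hat_curl_mx N wL wR c tau) eps mu tau h e h' e' ->
  mu * vseminorm2 wL wR w h' + eps * vseminorm2 wL wR w e' =
  mu * vseminorm2 wL wR w h + eps * vseminorm2 wL wR w e.
Proof.
move=> ltLR tau0 stepHE.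
have cP := vgrid_diff_comm_hat_curl N wL wR c tau w.
have AT := hat_curl_mx_sym N wL wR c tau.
move: (vgrid_diff N wL wR w) cP (vseminorm2E N wL wR w) => P cP normE.
(* transposing [P A = A P] gives the commutation of [A] with [P^T] *)
have cPT : hat_curl_mx N wL wR c tau *m P^T = P^T *m hat_curl_mx N wL wR c tau.
  by move: (congr1 trmx cP); rewrite !trmx_mul AT.
have /= := midpoint_step_conserves _ (P^T *m P) _ _ _ _ _ _ _ tau0 AT _ _ stepHE.
rewrite trmx_mul trmxK mulmxA cPT -!mulmxA cP => /(_ erefl erefl) conserved.
have factor (k a b : R) : mu * (k * a) + eps * (k * b) = k * (mu * a + eps * b).
  by ring.
by rewrite !normE // !factor conserved.
Qed.

(** Difference of the equations of two consecutive steps, divided by [tau]. *)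
Lemma midpoint_step_diffq {R : realType} {N : axis -> nat} (A : 'M[R]_(vsize N))
    (eps mu tau : R) (H E : nat -> 'cV[R]_(vsize N)) n :
  midpoint_step A eps mu tau (H n) (E n) (H n.+1) (E n.+1) ->
  midpoint_step A eps mu tau (H n.+1) (E n.+1) (H n.+2) (E n.+2) ->
  midpoint_step A eps mu tau (diffq tau H n.+1) (diffq tau E n.+1)
    (diffq tau H n.+2) (diffq tau E n.+2).
Proof.
move=> [h1 e1] [h2 e2]; rewrite /diffq /=.
have linS (x y z : 'cV[R]_(vsize N)) a :
    a *: (tau^-1 *: (tau^-1 *: (z - y) - tau^-1 *: (y - x))) =
    tau^-1 *: (a *: (tau^-1 *: (z - y)) - a *: (tau^-1 *: (y - x))).
  by apply/matrixP => i j; rewrite !mxE; ring.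
have linA (B : 'M[R]_(vsize N)) (x y z : 'cV[R]_(vsize N)) :
    B *m (2^-1 *: (tau^-1 *: (z - y) + tau^-1 *: (y - x))) =
    tau^-1 *: (B *m (2^-1 *: (z + y)) - B *m (2^-1 *: (y + x))).
  rewrite -mulmxBr scalemxAr; congr (_ *m _).
  by apply/matrixP => i j; rewrite !mxE; ring.
by split; rewrite linS linA ?h1 ?h2 ?e1 ?e2.
Qed.

Theorem theorem4p4 (R : realType) (N : axis -> nat) (wL wR : axis -> R)
    (N_gt0 : forall w, (0 < N w)%N) (N_even : forall w, ~~ odd (N w))
    (wL_lt_wR : forall w, wL w < wR w)
    (T : R) (T_gt0 : 0 < T) (M : nat) (M_gt0 : (0 < M)%N)
    (eps mu : R) (eps_gt0 : 0 < eps) (mu_gt0 : 0 < mu)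
    (tau : R) (tauE : tau = T / M%:R)
    (H E : nat -> 'cV[R]_(vsize N))
    (HE_sol : is_scheme_solution wL wR eps mu tau M H E) (w : axis) :
  (forall n, (n < M)%N ->
     energy4 wL wR eps mu H E w n.+1 = energy4 wL wR eps mu H E w n) /\
  (forall n, (1 <= n < M)%N ->
     energy5 wL wR eps mu tau H E w n.+1 = energy5 wL wR eps mu tau H E w n).
Proof.
have tau0 : tau != 0 by rewrite tauE gt_eqF // divr_gt0 // ltr0n.
split=> [n ltnM | [//|n] /andP[_ ltnM]].
  exact: (midpoint_step_vseminorm2 _ _ _ _ _ _ _ _ _ _ _ _ wL_lt_wR tau0 (HE_sol n ltnM)).
apply: (midpoint_step_vseminorm2 _ _ _ _ _ _ _ _ _ _ _ _ wL_lt_wR tau0).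
exact: (midpoint_step_diffq _ _ _ _ _ _ _ (HE_sol n (ltnW ltnM)) (HE_sol n.+1 ltnM)).
Qed.
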